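(* For integers $d,k$ let $G(d,k)\subset Sp_4(\mathbb{Z})$ be the subgroup generated by $$M_{d,k}=\begin{pmatrix}1&1&0&0\\0&1&0&0\\d&d&1&0\\0&-k&-1&1\end{pmatrix},\qquad N=\begin{pmatrix}1&0&0&0\\0&1&0&1\\0&0&1&0\\0&0&0&1\end{pmatrix}.$$ (i) The group $G(1,3)$ has index $6$ in $Sp_4(\mathbb{Z})$ and is exactly the group of all matrices $A\in Sp_4(\mathbb{Z})$ such that $A \bmod 2$ maps the following set of five vectors of $(\mathbb{Z}/2)^4$ to itself: $$\left\{\begin{pmatrix}0\\0\\0\\1\end{pmatrix},\begin{pmatrix}0\\1\\0\\1\end{pmatrix},\begin{pmatrix}0\\1\\1\\0\end{pmatrix},\begin{pmatrix}1\\1\\0\\0\end{pmatrix},\begin{pmatrix}1\\1\\1\\0\end{pmatrix}\right\}.$$ (ii) The group $G(1,2)$ has index $10$ in $Sp_4(\mathbb{Z})$ and is exactly the group of all matrices $A\in Sp_4(\mathbb{Z})$ such that $A \bmod 2$ preserves the following unordered pair of triples of vectors of $(\mathbb{Z}/2)^4$: $$\left\{\left\{\begin{pmatrix}0\\0\\1\\0\end{pmatrix},\begin{pmatrix}1\\1\\0\\0\end{pmatrix},\begin{pmatrix}1\\1\\1\\0\end{pmatrix}\right\},\left\{\begin{pmatrix}0\\0\\1\\1\end{pmatrix},\begin{pmatrix}0\\1\\0\\0\end{pmatrix},\begin{pmatrix}0\\1\\1\\1\end{pmatrix}\right\}\right\}.$$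
   Context: $Sp_4(\mathbb{Z})$ is the group of integral $4\times4$ matrices $X$ with $X^tSX=S$, where $$S=\begin{pmatrix}0&0&1&0\\0&0&0&1\\-1&0&0&0\\0&-1&0&0\end{pmatrix}.$$ Matrices act on column vectors by left multiplication. Preserving the unordered pair $\{T_1,T_2\}$ of triples means $\{A(T_1),A(T_2)\}=\{T_1,T_2\}$, i.e. $A$ either maps each triple to itself or interchanges the two triples. *)

(* Defs.v *)
From HB Require Import structures.
From mathcomp Require Import all_boot all_order all_algebra.
From mathcomp Require Import boolp classical_sets functions cardinality.
From mathcomp Require Import ring.

Set Implicit Arguments.
Unset Strict Implicit.
Unset Printing Implicit Defensive.

Import GRing.Theory.

Local Open Scope classical_set_scope.
Local Open Scope card_scope.

Section Subgroups.
Context {gT : groupType}.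
Implicit Types (H E : set gT) (g : gT).
Local Open Scope group_scope.

Definition is_subgroup H : Prop := group_closed [in H].

Definition gen_subgroup E : set gT := smallest is_subgroup E.

Definition left_coset H g : set gT := [set g * h | h in H].

(* The index is the number of left cosets g H; `I_n is the set {0, ..., n-1}. *)
Definition has_index H (n : nat) : Prop := range (left_coset H) #= `I_n.

End Subgroups.

Local Open Scope ring_scope.

Definition mx4 (s : seq (seq int)) : 'M[int]_4 :=
  \matrix_(i, j) nth 0 (nth [::] s i) j.

Definition mxS : 'M[int]_4 :=
  mx4 [:: [::  0;  0; 1; 0];
          [::  0;  0; 0; 1];
          [:: -1;  0; 0; 0];
          [::  0; -1; 0; 0]].

Definition mxM (d k : int) : 'M[int]_4 :=
  mx4 [:: [:: 1;  1;  0; 0];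
          [:: 0;  1;  0; 0];
          [:: d;  d;  1; 0];
          [:: 0; -k; -1; 1]].

Definition mxN : 'M[int]_4 :=
  mx4 [:: [:: 1; 0; 0; 0];
          [:: 0; 1; 0; 1];
          [:: 0; 0; 1; 0];
          [:: 0; 0; 0; 1]].

Definition symplectic : pred 'M[int]_4 := [pred X | X^T *m mxS *m X == mxS].

(* Sp_4(Z), with the matrix product as group law. *)
Record sp4 : predArgType :=
  Sp4 { sp4_val :> 'M[int]_4; sp4P : symplectic sp4_val }.

HB.instance Definition _ := [isSub for sp4_val].
HB.instance Definition _ := [Choice of sp4 by <:].

Lemma mxS_sq : mxS *m mxS = - 1%:M.
Proof.
apply/matrixP => i j; rewrite !mxE !big_ord_recr big_ord0 !mxE /=.
by case: i => [[|[|[|[|i]]]] Hi] //; case: j => [[|[|[|[|j]]]] Hj].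
Qed.

Lemma symplectic_unit X : symplectic X -> X \in unitmx.
Proof.
move=> /eqP XS; suff /mulmx1_unit[] : (- mxS *m X^T *m mxS) *m X = 1%:M by [].
by rewrite -!mulmxA [X^T *m _]mulmxA XS mulNmx mxS_sq opprK.
Qed.

Lemma symplectic1 : symplectic 1%:M.
Proof. by rewrite /symplectic /= trmx1 mul1mx mulmx1. Qed.

Lemma symplecticM X Y : symplectic X -> symplectic Y -> symplectic (X *m Y).
Proof.
move=> /eqP XS /eqP YS; apply/eqP.
by rewrite trmx_mul -!mulmxA [mxS *m _]mulmxA [X^T *m _]mulmxA mulmxA
     [X^T *m _]mulmxA XS.
Qed.

Lemma symplecticV X : symplectic X -> symplectic (invmx X).
Proof.
move=> XSP; have Xu := symplectic_unit XSP; move/eqP: XSP => XS; apply/eqP.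
rewrite -[in LHS]XS -!mulmxA mulmxV // mulmx1 mulmxA -trmx_mul mulmxV //.
by rewrite trmx1 mul1mx.
Qed.

Definition sp4_one : sp4 := Sp4 symplectic1.
Definition sp4_mul (X Y : sp4) : sp4 := Sp4 (symplecticM (sp4P X) (sp4P Y)).
Definition sp4_inv (X : sp4) : sp4 := Sp4 (symplecticV (sp4P X)).

Lemma sp4_mulA : associative sp4_mul.
Proof. by move=> X Y Z; apply/val_inj/mulmxA. Qed.
Lemma sp4_mul1l : left_id sp4_one sp4_mul.
Proof. by move=> X; apply/val_inj/mul1mx. Qed.
Lemma sp4_mul1r : right_id sp4_one sp4_mul.
Proof. by move=> X; apply/val_inj/mulmx1. Qed.
Lemma sp4_mulVl : left_inverse sp4_one sp4_inv sp4_mul.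
Proof. by move=> X; apply/val_inj/mulVmx/symplectic_unit/sp4P. Qed.
Lemma sp4_mulVr : right_inverse sp4_one sp4_inv sp4_mul.
Proof. by move=> X; apply/val_inj/mulmxV/symplectic_unit/sp4P. Qed.

HB.instance Definition _ :=
  isGroup.Build sp4 sp4_mulA sp4_mul1l sp4_mul1r sp4_mulVl sp4_mulVr.

Lemma symplecticMdk d k : symplectic (mxM d k).
Proof.
apply/eqP/matrixP => i j; rewrite !(mxE, big_ord_recr, big_ord0) /=.
case: i => [[|[|[|[|i]]]] Hi] //; case: j => [[|[|[|[|j]]]] Hj] //=;
  ring.
Qed.

Lemma symplecticN : symplectic mxN.
Proof.
apply/eqP/matrixP => i j; rewrite !(mxE, big_ord_recr, big_ord0) /=.
case: i => [[|[|[|[|i]]]] Hi] //; case: j => [[|[|[|[|j]]]] Hj] //=;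
  ring.
Qed.

Definition M (d k : int) : sp4 := Sp4 (symplecticMdk d k).
Definition N : sp4 := Sp4 symplecticN.

Definition G (d k : int) : set sp4 := gen_subgroup [set M d k; N].

(* The column vector with entries a, b, c, d from top to bottom. *)
Definition vec4 (a b c d : 'F_2) : 'cV['F_2]_4 :=
  \col_i nth 0 [:: a; b; c; d] i.

Definition mod2 (A : 'M[int]_4) : 'M['F_2]_4 := map_mx intr A.

Definition mod2_act (A : 'M[int]_4) (V : {set 'cV['F_2]_4}) :
    {set 'cV['F_2]_4} :=
  mulmx (mod2 A) @: V.

Definition quintuple : {set 'cV['F_2]_4} :=
  [set vec4 0 0 0 1; vec4 0 1 0 1; vec4 0 1 1 0; vec4 1 1 0 0;
       vec4 1 1 1 0]%SET.

Definition triple1 : {set 'cV['F_2]_4} :=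
  [set vec4 0 0 1 0; vec4 1 1 0 0; vec4 1 1 1 0]%SET.

Definition triple2 : {set 'cV['F_2]_4} :=
  [set vec4 0 0 1 1; vec4 0 1 0 0; vec4 0 1 1 1]%SET.

(* Main.v *)
From HB Require Import structures.
From Stdlib Require Import Ascii String.
Require Import Defs.
From mathcomp Require Import all_boot all_order all_algebra.
From mathcomp Require Import boolp classical_sets functions cardinality.
From mathcomp Require Import zify ring.

Set Implicit Arguments.
Unset Strict Implicit.
Unset Printing Implicit Defensive.

Import Order.TTheory GRing.Theory Num.Theory.

(** Both parts are instances of one coset argument.  Let $Sp_4(\mathbb{Z})$ act,
    by reduction mod 2, on families of subsets of $(\mathbb{Z}/2)^4$, and let
    [x0] be the family of the statement (one quintuple, or two triples).  The
    generators [M d k] and [N] fix [x0], so the group [H] they generate lies in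
    its stabilizer.  For the converse, take a finite list [r] of matrices,
    containing 1, whose images of [x0] are pairwise distinct, and suppose that
    for every [x] in a generating set of $Sp_4(\mathbb{Z})$ and every [g] in [r]
    there is [g'] in [r] with [x * g] in [g' H].  Then the cosets [g H] with
    [g] in [r] are permuted by the whole of $Sp_4(\mathbb{Z})$, hence exhaust
    it; they are distinct, because [H] fixes [x0] and so all elements of [g H]
    send [x0] to [act g x0].  Thus the index of [H] is the length of [r], and an
    element of [g H] that fixes [x0] has [g = 1], that is, belongs to [H].  This
    is [coset_table_stabilizer].

    Two ingredients remain.

    - A generating set of $Sp_4(\mathbb{Z})$.  Three matrices suffice
      ([sp4_generated]): the form [mxS] itself, the transvection [N], and the
      elementary matrix [E12 1].  They yield all elementary symplectic matrices,
      and Euclid's algorithm on the entries, carried out by such row operations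
      ([euclid_ind]), turns any symplectic matrix into an elementary one.

    - The coset tables.  The elements [g'^-1 * (x * g)] have to be exhibited in
      [H]; they occur in short lists of explicit words in [M d k], [N] and their
      inverses ([words13], [words12]), and [coset_table] checks by multiplying
      integer matrices that these lists are sufficient.  In particular the
      principal congruence subgroup of level 2 never has to be shown to lie
      in [H]: that is a consequence. *)

(** * Stabilizers and coset tables *)

Section Subgroups.
Context {gT : groupType}.
Implicit Types (H E : set gT) (g h : gT).
Local Open Scope group_scope.
Local Open Scope classical_set_scope.

Lemma subgroup1 H : is_subgroup H -> H 1.
Proof. by case=> /set_mem. Qed.

Lemma subgroupM H g h : is_subgroup H -> H g -> H h -> H (g * h).
Proof.
by move=> /group_closedM HM /mem_set Hg /mem_set Hh; apply/set_mem/HM.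
Qed.

Lemma subgroupV H g : is_subgroup H -> H g -> H g^-1.
Proof. by move=> /group_closedV HV /mem_set Hg; apply/set_mem/HV. Qed.

Lemma subgroupMl H g h : is_subgroup H -> H g -> H (g * h) <-> H h.
Proof.
move=> sH Hg; split=> [Hgh|]; last exact: subgroupM.
by rewrite -(mulKg g h); apply: subgroupM => //; apply: subgroupV.
Qed.

Lemma is_subgroupP H :
  H 1 -> (forall g h, H g -> H h -> H (g * h)) ->
  (forall g, H g -> H g^-1) -> is_subgroup H.
Proof.
move=> H1 HM HV; split=> [|g h /set_mem Hg /set_mem Hh]; apply/mem_set => //.
by apply: HM => //; apply: HV.
Qed.

Lemma gen_subgroup_subgroup E : is_subgroup (gen_subgroup E).
Proof.
apply: is_subgroupP => [H [sH _]|g h Eg Eh H HE|g Eg H HE].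
- exact: subgroup1.
- by apply: subgroupM; [case: HE|exact: Eg|exact: Eh].
- by apply: subgroupV; [case: HE|exact: Eg].
Qed.

Lemma mem_gen_subgroup E g : E g -> gen_subgroup E g.
Proof. exact: sub_gen_smallest. Qed.

Lemma gen_subgroup_sub E H : is_subgroup H -> E `<=` H -> gen_subgroup E `<=` H.
Proof. exact: smallest_sub. Qed.

Section CosetTable.
Context {T : eqType} (act : gT -> T -> T) (x0 : T).
Hypothesis act1 : forall x, act 1 x = x.
Hypothesis actM : forall g h x, act (g * h) x = act g (act h x).

Lemma stabilizer_subgroup : is_subgroup [set g | act g x0 = x0].
Proof.
apply: is_subgroupP => [|g h /= Eg Eh|g /= Eg] /=; first exact: act1.
  by rewrite actM Eh.
by rewrite -[in LHS]Eg -actM mulVg act1.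
Qed.

(** The stabilizer counterpart of coset enumeration.  The distinct points
    [act g x0] serve twice: they separate the cosets, and they show that a
    generator permutes the finitely many cosets of [r] instead of merely mapping
    them into one another, so that inverses of generators need no table. *)
Lemma coset_table_stabilizer (H X : set gT) (r : seq gT) :
  is_subgroup H -> gen_subgroup X = setT ->
  (forall h, H h -> act h x0 = x0) ->
  1 \in r -> uniq [seq act g x0 | g <- r] ->
  (forall x g, X x -> g \in r -> exists2 g', g' \in r & H (g'^-1 * (x * g))) ->
  has_index H (size r) /\ (forall g, H g <-> act g x0 = x0).
Proof.
move=> sH genX fixH r1 uniq_orbit table.
have act_inj g : injective (act g).
  by move=> y z /(congr1 (act g^-1)); rewrite -!actM mulVg !act1.
have actr_inj : {in r &, injective (fun g => act g x0)}.
  move=> g h /(nthP 1)[i ir <-] /(nthP 1)[j jr <-] /= ij; congr nth.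
  apply/eqP; rewrite -(nth_uniq x0 _ _ uniq_orbit) ?size_map //.
  by rewrite !(nth_map 1) ?ij.
have act_coset g k : H (g^-1 * k) -> act k x0 = act g x0.
  by move=> /fixH gk; rewrite -[k](mulVKg g) actM gk.
pose covered : set gT := [set k | exists2 g, g \in r & H (g^-1 * k)].
have coveredX x k : X x -> covered (x * k) <-> covered k.
  move=> Xx; split=> [[g gr gxk]|[g gr gk]]; last first.
    have [g' g'r g'xg] := table x g Xx gr; exists g' => //.
    rewrite -[k](mulVKg g) !mulgA -(mulgA g'^-1) -(mulgA _ _ k).
    by apply: subgroupM; rewrite // -mulgA.
  (* an injective self-map of a finite set is onto: g is reached from some h *)
  set O := [seq act g x0 | g <- r].
  have xO : {subset map (act x) O <= O}.
    move=> y /mapP[z /mapP[h hr ->] ->].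
    have [g' g'r /act_coset] := table x h Xx hr.
    by rewrite actM => ->; apply: map_f.
  have uxO : uniq (map (act x) O) by rewrite map_inj_uniq.
  have [|_ xOE] := uniq_min_size uxO xO; first by rewrite size_map.
  have := map_f (act^~ x0) gr; rewrite -/O -xOE.
  case/mapP=> _ /mapP[h hr ->] gxh.
  have [g' g'r g'xh] := table x h Xx hr; exists h => //.
  have g'g : g' = g.
    by apply: actr_inj; rewrite //= gxh -actM (act_coset _ _ g'xh).
  rewrite {g'}g'g in g'r g'xh *.
  have -> : h^-1 * k = (g^-1 * (x * h))^-1 * (g^-1 * (x * k)).
    by rewrite !invgM invgK !mulgA mulgK mulgVK.
  by apply: subgroupM => //; apply: subgroupV.
have covered_all k : covered k.
  pose K := [set x | forall k, covered (x * k) <-> covered k].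
  have sK : is_subgroup K.
    apply: is_subgroupP => [h|g h Kg Kh l|g Kg l]; first by rewrite mul1g.
      by rewrite -mulgA Kg Kh.
    by rewrite -[in X in _ <-> X](mulVKg g l) Kg.
  have /(gen_subgroup_sub sK) : X `<=` K by move=> x Xx l; apply: coveredX.
  rewrite genX => /(_ k I 1); rewrite mulg1 => ->.
  by exists 1 => //; rewrite invg1 mulg1; apply: subgroup1.
split; last first.
  move=> k; split=> [/fixH//|kx0]; have [g gr gk] := covered_all k.
  have g1 : g = 1 by apply: actr_inj; rewrite //= act1 -(act_coset _ _ gk).
  by move: gk; rewrite g1 invg1 mul1g.
have coset_eq g k : H (g^-1 * k) -> left_coset H k = left_coset H g.
  move=> gk; apply/seteqP; split=> _ [h Hh <-].
    by exists (g^-1 * k * h); [exact: subgroupM|rewrite !mulgA mulgV mul1g].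
  exists ((g^-1 * k)^-1 * h); first by apply: subgroupM => //; apply: subgroupV.
  by rewrite invgM invgK !mulgA mulgV mul1g.
rewrite /has_index.
have -> : range (left_coset H) =
          (fun i => left_coset H (nth 1 r i)) @` `I_(size r).
  apply/seteqP; split=> [_ [k _ <-]|_ [i _ <-]]; last by exists (nth 1 r i).
  have [g gr gk] := covered_all k.
  exists (index g r); first by rewrite /= index_mem.
  by rewrite nth_index // (coset_eq _ _ gk).
apply: inj_card_eq => i j /set_mem/= ir /set_mem/= jr ijH.
have : left_coset H (nth 1 r j) (nth 1 r i).
  rewrite -ijH; exists 1; [exact: subgroup1|exact: mulg1].
case=> h Hh hE; have ijE : act (nth 1 r i) x0 = act (nth 1 r j) x0.
  by rewrite -hE actM fixH.
apply/eqP; rewrite -(nth_uniq x0 _ _ uniq_orbit) ?size_map //.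
by rewrite !(nth_map 1) // ijE.
Qed.

End CosetTable.
End Subgroups.

(** * Euclid's algorithm as an induction principle *)

Section EuclidInduction.
Local Open Scope ring_scope.
Variables (T : Type) (x y : T -> int) (U L : int -> T -> T) (P K : T -> Prop).
Hypothesis PU : forall t A, P A -> P (U t A).
Hypothesis PL : forall t A, P A -> P (L t A).
Hypothesis xU : forall t A, P A -> x (U t A) = x A + t * y A.
Hypothesis yU : forall t A, P A -> y (U t A) = y A.
Hypothesis xL : forall t A, P A -> x (L t A) = x A.
Hypothesis yL : forall t A, P A -> y (L t A) = y A + t * x A.
Hypothesis KU : forall t A, P A -> K (U t A) -> K A.
Hypothesis KL : forall t A, P A -> K (L t A) -> K A.

(** [x] and [y] are two coordinates of an object, [U t] adds [t] times the
    second to the first, [L t] adds [t] times the first to the second.  A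
    property [K] that can be pulled back along these operations need only be
    proved where Euclid's algorithm stops.  [P] is an invariant of the
    operations, which records the coordinates that are already normalized. *)
Lemma euclid_ind :
  (forall A, P A -> y A = 0 -> 0 <= x A -> K A) -> forall A, P A -> K A.
Proof.
move=> base.
have base0 A : P A -> y A = 0 -> K A.
  move=> PA y0; have [x0|x0] := lerP 0 (x A); first exact: base.
  (* (x, 0) -> (x, -x) -> (-x, -x) -> (-x, 0) *)
  apply: (KL (t := -1)) => //; apply: (KU (t := 2)); first exact: PL.
  apply: (KL (t := -1)); first exact/PU/PL.
  apply: base; first exact/PL/PU/PL.
    by rewrite !(yL, yU, xU, xL); do ?[apply: PL|apply: PU]; rewrite //; lia.
  by rewrite !(yL, yU, xU, xL); do ?[apply: PL|apply: PU]; rewrite //; lia.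
move=> A; have [n] := ubnP (`|x A| + `|y A|)%N; elim: n A => // n IHn A An PA.
have [y0|y0] := eqVneq (y A) 0; first exact: base0.
have [x0|x0] := eqVneq (x A) 0.
  apply: (KU (t := 1)) => //; apply: (KL (t := -1)); first exact: PU.
  apply: base0; first exact/PL/PU.
  by rewrite !(yL, yU, xU, xL); do ?apply: PU; rewrite //; lia.
have [t tE] : exists2 t : int, t = 1 \/ t = -1 &
    (`|x A + t * y A| < `|x A|) \/ (`|y A + t * x A| < `|y A|).
  have [xy|xy] := boolP ((0 < x A) == (0 < y A)); [exists (-1)|exists 1]; lia.
case=> lt_t; [apply: (KU (t := t)) => //|apply: (KL (t := t)) => //];
  apply: IHn.
- by rewrite xU // yU //; lia.
- exact: PU.
- by rewrite xL // yL //; lia.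
- exact: PL.
Qed.
End EuclidInduction.

(** * Computing with explicit matrices *)

Local Notation "'e0" := (@Ordinal 4 0 isT).
Local Notation "'e1" := (@Ordinal 4 1 isT).
Local Notation "'e2" := (@Ordinal 4 2 isT).
Local Notation "'e3" := (@Ordinal 4 3 isT).

Section ExplicitMatrices.
Local Open Scope ring_scope.

(** Lists of rows evaluate, unlike the entries of a matrix; [mx4M] lets every
    product of explicit matrices be carried out on lists. *)
Definition mul4 (s t : seq (seq int)) : seq (seq int) :=
  mkseq (fun i => mkseq (fun j =>
    let a k l := nth 0 (nth [::] s k) l in
    let b k l := nth 0 (nth [::] t k) l in
    a i 0%N * b 0%N j + a i 1%N * b 1%N j
    + a i 2%N * b 2%N j + a i 3%N * b 3%N j) 4) 4.

Definition tr4 (s : seq (seq int)) : seq (seq int) :=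
  mkseq (fun i => mkseq (fun j => nth 0 (nth [::] s j) i) 4) 4.

Definition id4 : seq (seq int) :=
  [:: [:: 1; 0; 0; 0]; [:: 0; 1; 0; 0]; [:: 0; 0; 1; 0]; [:: 0; 0; 0; 1]].

Lemma mulmx4E p s (A : 'M[int]_(4, p)) (i : 'I_4) j :
  let a k := nth 0 (nth [::] s i) k in
  (mx4 s *m A) i j =
    a 0%N * A 'e0 j + a 1%N * A 'e1 j + a 2%N * A 'e2 j + a 3%N * A 'e3 j.
Proof.
rewrite mxE !big_ord_recr big_ord0 !mxE /= add0r.
by do !congr (_ + _); congr (_ * A _ _); apply: val_inj.
Qed.

Lemma mx4M s t : mx4 s *m mx4 t = mx4 (mul4 s t).
Proof.
by apply/matrixP=> i j; rewrite mulmx4E !mxE !(nth_mkseq, ltn_ord).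
Qed.

Lemma mx4T s : (mx4 s)^T = mx4 (tr4 s).
Proof. by apply/matrixP=> i j; rewrite !mxE !(nth_mkseq, ltn_ord). Qed.

Lemma mx4_id : mx4 id4 = 1%:M.
Proof.
apply/matrixP => i j; rewrite !mxE.
by case: i => [[|[|[|[|i]]]] ?] //; case: j => [[|[|[|[|j]]]] ?].
Qed.

(** The symplectic form applied to columns [j] and [k]. *)
Lemma sp4_form (A : sp4) j k :
  A 'e0 j * A 'e2 k + A 'e1 j * A 'e3 k - A 'e2 j * A 'e0 k - A 'e3 j * A 'e1 k
  = mxS j k.
Proof.
have /eqP/matrixP/(_ j k) <- := sp4P A.
rewrite -mulmxA mxE !big_ord_recr big_ord0 /= !mulmx4E !mxE /=.
rewrite (_ : widen_ord _ _ = 'e0); last exact: val_inj.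
rewrite (_ : widen_ord _ _ = 'e1); last exact: val_inj.
rewrite (_ : widen_ord _ _ = 'e2); last exact: val_inj.
rewrite (_ : ord_max = 'e3); last exact: val_inj.
ring.
Qed.
End ExplicitMatrices.

Local Ltac mx4_ring :=
  rewrite ?mx4T !mx4M; congr mx4; rewrite /mul4 /mkseq /=;
  do ?apply: (f_equal2 cons); (ring || exact: erefl).

Local Ltac sp4_ring := apply: val_inj; rewrite /=; mx4_ring.

(** * A generating set of the symplectic group *)

Section Elementary.
Local Open Scope ring_scope.
Implicit Types t : int.

Definition mx13 t :=
  mx4 [:: [:: 1; 0; t; 0]; [:: 0; 1; 0; 0]; [:: 0; 0; 1; 0]; [:: 0; 0; 0; 1]].
Definition mx31 t :=
  mx4 [:: [:: 1; 0; 0; 0]; [:: 0; 1; 0; 0]; [:: t; 0; 1; 0]; [:: 0; 0; 0; 1]].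
Definition mx24 t :=
  mx4 [:: [:: 1; 0; 0; 0]; [:: 0; 1; 0; t]; [:: 0; 0; 1; 0]; [:: 0; 0; 0; 1]].
Definition mx42 t :=
  mx4 [:: [:: 1; 0; 0; 0]; [:: 0; 1; 0; 0]; [:: 0; 0; 1; 0]; [:: 0; t; 0; 1]].
Definition mx12 t :=
  mx4 [:: [:: 1; t; 0; 0]; [:: 0; 1; 0; 0]; [:: 0; 0; 1; 0]; [:: 0; 0; - t; 1]].
Definition mx21 t :=
  mx4 [:: [:: 1; 0; 0; 0]; [:: t; 1; 0; 0]; [:: 0; 0; 1; - t]; [:: 0; 0; 0; 1]].
Definition mx14 t :=
  mx4 [:: [:: 1; 0; 0; t]; [:: 0; 1; t; 0]; [:: 0; 0; 1; 0]; [:: 0; 0; 0; 1]].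

Lemma symplectic13 t : symplectic (mx13 t). Proof. by apply/eqP; mx4_ring. Qed.
Lemma symplectic31 t : symplectic (mx31 t). Proof. by apply/eqP; mx4_ring. Qed.
Lemma symplectic24 t : symplectic (mx24 t). Proof. by apply/eqP; mx4_ring. Qed.
Lemma symplectic42 t : symplectic (mx42 t). Proof. by apply/eqP; mx4_ring. Qed.
Lemma symplectic12 t : symplectic (mx12 t). Proof. by apply/eqP; mx4_ring. Qed.
Lemma symplectic21 t : symplectic (mx21 t). Proof. by apply/eqP; mx4_ring. Qed.
Lemma symplectic14 t : symplectic (mx14 t). Proof. by apply/eqP; mx4_ring. Qed.
Lemma symplecticS : symplectic mxS. Proof. by apply/eqP; mx4_ring. Qed.

(** With rows numbered from 1, [Eij t] adds [t] times row [j] to row [i],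
    together with what symplecticity then imposes: nothing for [E13], [E31],
    [E24], [E42], which are transvections, and a second row operation for [E12],
    [E21], [E14]. *)
Definition E13 t : sp4 := Sp4 (symplectic13 t).
Definition E31 t : sp4 := Sp4 (symplectic31 t).
Definition E24 t : sp4 := Sp4 (symplectic24 t).
Definition E42 t : sp4 := Sp4 (symplectic42 t).
Definition E12 t : sp4 := Sp4 (symplectic12 t).
Definition E21 t : sp4 := Sp4 (symplectic21 t).
Definition E14 t : sp4 := Sp4 (symplectic14 t).
Definition sp4S : sp4 := Sp4 symplecticS.

Lemma one_parameter_subgroup (H : set sp4) (E : int -> sp4) :
  is_subgroup H -> (forall s t, E (s + t) = (E s * E t)%g) -> H (E 1) ->
  forall t, H (E t).
Proof.
move=> sH ED H1.
have E0 : E 0 = 1%g by rewrite -[LHS](mulgK (E 0)) -ED addr0 mulgV.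
have Hn n : H (E (Posz n)).
  elim: n => [|n IHn]; first by rewrite E0; apply: subgroup1.
  by rewrite intS ED; apply: subgroupM.
case=> n; first exact: Hn.
have -> : E (Negz n) = (E n.+1)^-1%g.
  by rewrite -[LHS](mulgK (E n.+1)) -ED NegzE addNr E0 mul1g.
exact: subgroupV.
Qed.

Lemma mulz_eq1 (a b : int) : 0 <= a -> a * b = 1 -> a = 1 /\ b = 1.
Proof.
move=> a0 ab1.
have /intUnitRing.unitzPl/orP[/eqP a1|/eqP a1] : b * a = 1 by rewrite mulrC.
  by move: ab1; rewrite a1 mul1r.
by move: a0; rewrite a1.
Qed.
End Elementary.

Section Generation.
Local Open Scope ring_scope.
Variable H : set sp4.
Hypothesis sH : is_subgroup H.
Hypothesis memS : H sp4S.
Hypothesis mem24_1 : H (E24 1).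
Hypothesis mem12_1 : H (E12 1).
Implicit Types (t : int) (A B : sp4).

Lemma mem_conj g A B : H g -> H A -> (g * A)%g = (B * g)%g -> H B.
Proof.
move=> Hg HA gA; have -> : B = (g * A * g^-1)%g by rewrite gA mulgK.
by apply: subgroupM; [|exact: subgroupM|exact: subgroupV].
Qed.

Lemma mem24 t : H (E24 t).
Proof. by apply: one_parameter_subgroup t => // s t; sp4_ring. Qed.

Lemma mem12 t : H (E12 t).
Proof. by apply: one_parameter_subgroup t => // s t; sp4_ring. Qed.

Lemma mem42 t : H (E42 t).
Proof. by apply: (mem_conj memS (mem24 (- t))); sp4_ring. Qed.

Lemma mem21 t : H (E21 t).
Proof. by apply: (mem_conj memS (mem12 (- t))); sp4_ring. Qed.

(** The conjugating element is a quarter turn exchanging the two hyperbolic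
    planes. *)
Lemma mem13 t : H (E13 t).
Proof.
apply: (@mem_conj (E12 1 * (E21 (-1) * E12 1))%g (E24 t)); last by sp4_ring.
  exact: (subgroupM sH (mem12 _) (subgroupM sH (mem21 _) (mem12 _))).
exact: mem24.
Qed.

Lemma mem31 t : H (E31 t).
Proof. by apply: (mem_conj memS (mem13 (- t))); sp4_ring. Qed.

(** [E12 1] substitutes $x + y$ for $y$ in the quadratic form $t y^2$ attached
    to [E24 t]; the mixed term of $t (x + y)^2$ is [E14 t]. *)
Lemma mem14 t : H (E14 t).
Proof.
have := subgroupM sH (mem12 1) (subgroupM sH (mem24 t) (mem12 (-1))).
have -> : (E12 1 * (E24 t * E12 (-1)))%g = (E13 t * (E24 t * E14 t))%g.
  by sp4_ring.
by rewrite (subgroupMl _ sH (mem13 t)) (subgroupMl _ sH (mem24 t)).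
Qed.

Let col0 A :=
  [/\ A 'e0 'e0 = 1, A 'e1 'e0 = 0, A 'e2 'e0 = 0 & A 'e3 'e0 = 0].
Let col2 A :=
  [/\ A 'e0 'e2 = 0, A 'e1 'e2 = 0, A 'e2 'e2 = 1 & A 'e3 'e2 = 0].

Local Ltac entries := move=> *; rewrite /= !mulmx4E /=;
  repeat match goal with h : _ = _ |- _ => rewrite ?h; clear h end; ring.

(** A matrix fixing the first hyperbolic plane is an element of $SL_2$ on the
    second one. *)
Lemma fix_plane_mem A : col0 A -> col2 A -> H A.
Proof.
move=> A0 A2; have {A0 A2} : col0 A /\ col2 A by [].
move: A; apply: (@euclid_ind sp4 (fun A => A 'e1 'e1) (fun A => A 'e3 'e1)
  (fun t A => (E24 t * A)%g) (fun t A => (E42 t * A)%g)).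
1,2: by move=> t B [[? ? ? ?] [? ? ? ?]]; split; split; entries.
1-4: by entries.
- by move=> t B _; rewrite (subgroupMl B sH (mem24 t)).
- by move=> t B _; rewrite (subgroupMl B sH (mem42 t)).
move=> A [[a00 a10 a20 a30] [a02 a12 a22 a32]] a31 a11_ge0.
suff -> : A = E24 (A 'e1 'e3) by apply: mem24.
apply/val_inj/matrixP => i j; rewrite !mxE; have F := sp4_form A.
(* the form against columns 0 and 2 determines rows 2 and 0 *)
move: (F 'e0 'e1) (F 'e0 'e3) (F 'e2 'e1) (F 'e2 'e3) (F 'e1 'e3).
rewrite !mxE a00 a10 a20 a30 a02 a12 a22 a32 a31 /= => f01 f03 f21 f23 f13.
have [a11 a33] : A 'e1 'e1 = 1 /\ A 'e3 'e3 = 1 by apply: mulz_eq1 => //; lia.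
case: i => [[|[|[|[|i]]]] Hi] //; case: j => [[|[|[|[|j]]]] Hj] //=;
  rewrite !(bool_irrelevance Hi isT) !(bool_irrelevance Hj isT); lia.
Qed.

(** Once the first column is a basis vector, the third one pairs to 1 with it,
    and three row operations that fix the first column clear the third. *)
Lemma fix_col0_mem A : col0 A -> H A.
Proof.
move=> A0; have [a00 a10 a20 a30] := A0.
pose t3 := A 'e3 'e2; pose t1 := - A 'e1 'e2.
(* the entry (0, 2) as it is after the operation [E12 t3] *)
pose t0 := - A 'e0 'e2 - A 'e1 'e2 * A 'e3 'e2.
rewrite -(subgroupMl A sH (mem12 t3)) -(subgroupMl _ sH (mem14 t1)).
rewrite -(subgroupMl _ sH (mem13 t0)).
have := sp4_form A 'e0 'e2; rewrite !mxE a00 a10 a20 a30 /= => f02.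
have a22 : A 'e2 'e2 = 1 by lia.
apply: fix_plane_mem; split;
  by rewrite /= !mulmx4E /= ?a00 ?a10 ?a20 ?a30 ?a22 /t0 /t1 /t3; ring.
Qed.

(** Three runs of Euclid's algorithm reduce the first column to a multiple of a
    basis vector: one in each hyperbolic plane, then one between the planes.
    The form makes that multiple a unit. *)
Lemma sp4_mem A : H A.
Proof.
apply: (@euclid_ind sp4 (fun A => A 'e0 'e0) (fun A => A 'e2 'e0)
  (fun t A => (E13 t * A)%g) (fun t A => (E31 t * A)%g) (fun=> True)) => //.
1-4: by entries.
- by move=> t B _; rewrite (subgroupMl B sH (mem13 t)).
- by move=> t B _; rewrite (subgroupMl B sH (mem31 t)).
move=> {}A _ a20 _; move: A a20.
apply: (@euclid_ind sp4 (fun A => A 'e1 'e0) (fun A => A 'e3 'e0)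
  (fun t A => (E24 t * A)%g) (fun t A => (E42 t * A)%g)).
1-6: by entries.
- by move=> t B _; rewrite (subgroupMl B sH (mem24 t)).
- by move=> t B _; rewrite (subgroupMl B sH (mem42 t)).
move=> A a20 a30 _; have {a20 a30} : A 'e2 'e0 = 0 /\ A 'e3 'e0 = 0 by [].
move: A; apply: (@euclid_ind sp4 (fun A => A 'e0 'e0) (fun A => A 'e1 'e0)
  (fun t A => (E12 t * A)%g) (fun t A => (E21 t * A)%g)).
1,2: by move=> t B [? ?]; split; entries.
1-4: by move=> t B [? ?]; entries.
- by move=> t B _; rewrite (subgroupMl B sH (mem12 t)).
- by move=> t B _; rewrite (subgroupMl B sH (mem21 t)).
move=> A [a20 a30] a10 a00_ge0; apply: fix_col0_mem; split=> //.
have := sp4_form A 'e0 'e2; rewrite !mxE a10 a20 a30 /= => f02.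
by have [] : A 'e0 'e0 = 1 /\ A 'e2 'e2 = 1 by apply: mulz_eq1 => //; lia.
Qed.
End Generation.

Lemma sp4_generated : gen_subgroup [set sp4S; N; E12 1]%classic = setT.
Proof.
apply/seteqP; split=> // A _; have sH := gen_subgroup_subgroup
  [set sp4S; N; E12 1]%classic.
apply: (sp4_mem sH); apply: mem_gen_subgroup; [by left; left| |by right].
by left; right; apply: val_inj.
Qed.

(** * Words in the generators *)

HB.instance Definition _ := hasDecEq.Build string String.eqb_spec.

Section Words.
Local Open Scope ring_scope.

Variables d k : int.

(** Lower case letters are inverses; [S] and [D], which with [N] generate the
    symplectic group, are used to spell coset representatives. *)
Definition letter (c : ascii) : sp4 :=
  match c with
  | "M" => M d k | "m" => (M d k)^-1
  | "N" => N     | "n" => N^-1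
  | "S" => sp4S  | "D" => E12 1
  | _ => 1
  end%char%g.

Definition letter4 (c : ascii) : seq (seq int) :=
  match c with
  | "M" => [:: [:: 1; 1; 0; 0]; [:: 0; 1; 0; 0]; [:: d; d; 1; 0];
               [:: 0; -k; -1; 1]]
  | "m" => [:: [:: 1; -1; 0; 0]; [:: 0; 1; 0; 0]; [:: -d; 0; 1; 0];
               [:: -d; k; 1; 1]]
  | "N" => [:: [:: 1; 0; 0; 0]; [:: 0; 1; 0; 1]; [:: 0; 0; 1; 0];
               [:: 0; 0; 0; 1]]
  | "n" => [:: [:: 1; 0; 0; 0]; [:: 0; 1; 0; -1]; [:: 0; 0; 1; 0];
               [:: 0; 0; 0; 1]]
  | "S" => [:: [:: 0; 0; 1; 0]; [:: 0; 0; 0; 1]; [:: -1; 0; 0; 0];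
               [:: 0; -1; 0; 0]]
  | "D" => [:: [:: 1; 1; 0; 0]; [:: 0; 1; 0; 0]; [:: 0; 0; 1; 0];
               [:: 0; 0; -1; 1]]
  | _ => id4
  end%char.

Lemma sp4_invE (A : sp4) s : A *m mx4 s = 1%:M -> val (A^-1)%g = mx4 s.
Proof.
move=> As; rewrite -[RHS]mul1mx -(mulVmx (symplectic_unit (sp4P A))).
by rewrite -mulmxA As mulmx1.
Qed.

Lemma letterE c : val (letter c) = mx4 (letter4 c).
Proof.
have Minv : val (M d k)^-1%g = mx4 (letter4 "m").
  by apply: sp4_invE; rewrite -mx4_id /= /mxM; mx4_ring.
have Ninv : val N^-1%g = mx4 (letter4 "n").
  by apply: sp4_invE; rewrite -mx4_id /= /mxN; mx4_ring.
case: c => -[] [] [] [] [] [] [] [];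
  by rewrite /letter /letter4 ?Minv ?Ninv ?mx4_id.
Qed.

Fixpoint word (w : string) : sp4 :=
  if w is String c w' then (letter c * word w')%g else 1%g.

Fixpoint word4 (w : string) : seq (seq int) :=
  if w is String c w' then mul4 (letter4 c) (word4 w') else id4.

Lemma wordE w : val (word w) = mx4 (word4 w).
Proof. by elim: w => [|c w IHw] /=; rewrite ?mx4_id // letterE IHw mx4M. Qed.

Fixpoint MN_word (w : string) : bool :=
  if w is String c w' then
    match c with "M" | "m" | "N" | "n" => MN_word w' | _ => false end%char
  else true.

Lemma MN_word_mem w : MN_word w -> G d k (word w).
Proof.
have sG : is_subgroup (G d k) := gen_subgroup_subgroup _.
have GM : G d k (M d k) by apply: mem_gen_subgroup; left.
have GN : G d k N by apply: mem_gen_subgroup; right.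
have [GM' GN'] := (subgroupV sG GM, subgroupV sG GN).
elim: w => [|c w IHw] /=; first by move=> _; apply: subgroup1.
by case: c => -[] [] [] [] [] [] [] [] // /IHw Gw; apply: (subgroupM sG).
Qed.
End Words.

(** * Families of subsets of the reduction mod 2 *)

Section Reduction.
Local Open Scope ring_scope.
Notation F24 := 'cV['F_2]_4.

Definition seq_equiv {X} (e : rel X) (s t : seq X) : bool :=
  all (fun x => has (e x) t) s && all (fun y => has (e y) s) t.

(** Turns an equality of finite sets given by lists into a boolean that
    evaluates; applied once to sets of vectors and once more to sets of such
    sets. *)
Lemma set_map_eq {X : Type} {Y : finType} (f : X -> Y) (e : rel X) :
  (forall x y, (f x == f y) = e x y) ->
  forall s t,
    ([set y in map f s] == [set y in map f t]) = seq_equiv e s t.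
Proof.
move=> fe s t.
have mem_f x u : (f x \in [set y in map f u]) = has (e x) u.
  by rewrite inE; elim: u => //= y u <-; rewrite in_cons fe.
have sub_f u (B : {set Y}) :
    ([set y in map f u] \subset B) = all (fun x => f x \in B) u.
  elim: u => [|x u IHu]; first by rewrite finset.set_nil finset.sub0set.
  by rewrite map_cons finset.set_cons finset.subUset finset.sub1set IHu.
rewrite finset.eqEsubset !sub_f.
by congr (_ && _); apply: eq_all => x; apply: mem_f.
Qed.

(** Vectors mod 2 are represented by integer vectors, so that the action of
    a matrix mod 2 is an integer product followed by one comparison of
    parities. *)
Definition vec (v : seq int) : F24 := map_mx intr (\col_(i < 4) v`_i).

Definition parity (v : seq int) : seq bool := mkseq (fun i => odd `|v`_i|) 4.

Definition vec_equiv v w := parity v == parity w.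

Lemma intr_F2 (z : int) : z%:~R = (odd `|z|)%:R :> 'F_2.
Proof.
have natF2 n : n%:R = (odd n)%:R :> 'F_2.
  by apply: val_inj; rewrite /= !val_Zp_nat //= modn2; case: odd.
case: z => n; first exact: natF2.
rewrite [in LHS]NegzE mulrNz -pmulrn (natF2 n.+1) [absz _]/=.
by case: (odd _); apply: val_inj.
Qed.

Lemma vec_eq v w : (vec v == vec w) = vec_equiv v w.
Proof.
have F2_inj (a b : bool) : (a%:R == b%:R :> 'F_2) = (a == b).
  by case: a; case: b.
apply/eqP/eqP => [/matrixP vw|vw].
  apply: (@eq_from_nth _ false); rewrite !size_mkseq // => i i4.
  rewrite !nth_mkseq //; apply/eqP; rewrite -F2_inj -!intr_F2; apply/eqP.
  by have := vw (Ordinal i4) 0; rewrite !mxE.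
apply/matrixP => i j; rewrite !mxE !intr_F2; congr (_%:R); congr (_ _).
by have := congr1 (fun s => nth false s i) vw; rewrite !nth_mkseq // => ->.
Qed.

Definition block (s : seq (seq int)) : {set F24} := [set v in map vec s].

Definition blocks (F : seq (seq (seq int))) : {set {set F24}} :=
  [set V in map block F].

Definition blocks_equiv := seq_equiv (seq_equiv vec_equiv).

Lemma blocks_eq F F' : (blocks F == blocks F') = blocks_equiv F F'.
Proof. exact/set_map_eq/set_map_eq/vec_eq. Qed.

Definition block_act (A : sp4) (P : {set {set F24}}) : {set {set F24}} :=
  [set mod2_act A V | V in P].

Lemma block_act1 P : block_act 1%g P = P.
Proof.
rewrite /block_act -[RHS]imset_id; apply: eq_imset => V.
rewrite /mod2_act -[RHS]imset_id; apply: eq_imset => v.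
by rewrite /mod2 /= map_mx1 mul1mx.
Qed.

Lemma block_actM A B P : block_act (A * B)%g P = block_act A (block_act B P).
Proof.
rewrite /block_act -imset_comp; apply: eq_imset => V.
rewrite /mod2_act /= -imset_comp; apply: eq_imset => v.
by rewrite /mod2 /= map_mxM mulmxA.
Qed.

Definition mulv4 (s : seq (seq int)) (v : seq int) : seq int :=
  mkseq (fun i => let a j := nth 0 (nth [::] s i) j in
    a 0%N * v`_0 + a 1%N * v`_1 + a 2%N * v`_2 + a 3%N * v`_3) 4.

Lemma block_act_blocks (A : sp4) s F :
  val A = mx4 s -> block_act A (blocks F) = blocks (map (map (mulv4 s)) F).
Proof.
move=> As.
have imset_seq (X Y : finType) (f : X -> Y) u :
    [set f x | x in [set x in u]] = [set y in map f u].
  elim: u => [|x u IHu]; first by rewrite !finset.set_nil imset0.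
  by rewrite map_cons !finset.set_cons imsetU1 IHu.
have vecE v : mod2 A *m vec v = vec (mulv4 s v).
  rewrite /mod2 As /vec -map_mxM; congr map_mx; apply/matrixP => i j.
  by rewrite mulmx4E !mxE nth_mkseq.
rewrite /block_act /blocks imset_seq -!map_comp; congr (finset _).
apply/funext => V; congr (_ \in _); apply: eq_map => u /=.
rewrite /block /mod2_act imset_seq -!map_comp; congr (finset _).
apply/funext => v; congr (_ \in _); apply: eq_map => {}v /=; exact: vecE.
Qed.

(** * The coset tables *)

(** The hypotheses of [coset_table_stabilizer], in a form that evaluates:
    [reps] spell the coset representatives, and every [g'^-1 * (x * g)] has to
    be one of the [words].  The local definitions make each word be multiplied
    out only once. *)
Definition coset_table (d k : int) (F : seq (seq (seq int)))
    (reps words : seq string) : bool :=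
  let gens4 := [:: letter4 d k "S"; letter4 d k "N"; letter4 d k "D"] in
  let reps4 := map (word4 d k) reps in
  let words4 := map (word4 d k) words in
  let act s := map (map (mulv4 s)) F in
  [&& all MN_word words,
      all (fun c => blocks_equiv (act (letter4 d k c)) F) [:: "M"; "N"]%char,
      pairwise (fun s t => ~~ blocks_equiv (act s) (act t)) reps4
    & all (fun s => all (fun g => has (fun g' => has (fun w =>
        mul4 s g == mul4 g' w) words4) reps4) reps4) gens4].

Lemma coset_table_correct d k F reps words :
  coset_table d k F (EmptyString :: reps) words ->
  has_index (G d k) (size reps).+1 /\
  (forall A, G d k A <-> block_act A (blocks F) = blocks F).
Proof.
rewrite /coset_table; set r := EmptyString :: reps; cbv zeta.
case/and4P=> wordsP fixF distinct table.
have sG : is_subgroup (G d k) := gen_subgroup_subgroup _.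
have act_word w : block_act (word d k w) (blocks F) =
    blocks (map (map (mulv4 (word4 d k w))) F).
  exact/block_act_blocks/wordE.
have sStab := stabilizer_subgroup (blocks F) block_act1 block_actM.
have fixG A : G d k A -> block_act A (blocks F) = blocks F.
  case/and3P: fixF; rewrite -!blocks_eq => /eqP fixM /eqP fixN _ GA.
  apply: (gen_subgroup_sub sStab _ GA) => _ /= [] ->.
    by rewrite (block_act_blocks _ (letterE d k "M"%char)).
  by rewrite (block_act_blocks _ (letterE d k "N"%char)).
have -> : (size reps).+1 = size (map (word d k) r) by rewrite size_map.
apply: (coset_table_stabilizer block_act1 block_actM
  (X := [set sp4S; N; E12 1]%classic)) => //.
- exact: sp4_generated.
- by rewrite map_cons in_cons eqxx.
- rewrite uniq_pairwise -map_comp pairwise_map.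
  move: distinct; rewrite pairwise_map.
  apply: sub_pairwise => u v /=; rewrite !act_word blocks_eq; exact.
move=> x g xgen gr.
have [c cgens ->] : exists2 c, letter4 d k c \in
    [:: letter4 d k "S"; letter4 d k "N"; letter4 d k "D"] & x = letter d k c.
  case: xgen => [[->|->]|->];
    [exists "S"%char|exists "N"%char|exists "D"%char];
    by rewrite ?in_cons ?eqxx ?orbT.
case/mapP: gr => u ur ->.
have := allP (allP table _ cgens) _ (map_f (word4 d k) ur).
case/hasP=> _ /mapP[v vr ->] /hasP[_ /mapP[w ww ->] /eqP cu_vw].
exists (word d k v); first exact: map_f.
have -> : (letter d k c * word d k u = word d k v * word d k w)%g.
  apply: val_inj; transitivity (mx4 (mul4 (letter4 d k c) (word4 d k u))).
    by rewrite -mx4M -letterE -wordE.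
  by rewrite cu_vw -mx4M -!wordE.
by rewrite mulKg; apply: MN_word_mem; apply: (allP wordsP).
Qed.

Definition quintuple_vecs : seq (seq int) :=
  [:: [:: 0; 0; 0; 1]; [:: 0; 1; 0; 1]; [:: 0; 1; 1; 0]; [:: 1; 1; 0; 0];
      [:: 1; 1; 1; 0]].

Definition triple1_vecs : seq (seq int) :=
  [:: [:: 0; 0; 1; 0]; [:: 1; 1; 0; 0]; [:: 1; 1; 1; 0]].

Definition triple2_vecs : seq (seq int) :=
  [:: [:: 0; 0; 1; 1]; [:: 0; 1; 0; 0]; [:: 0; 1; 1; 1]].

(** Both lists of representatives start with the empty word and go through the
    orbit of the family under [S], [N], [D]. *)
Definition reps13 : seq string :=
  [:: ""; "D"; "S"; "DS"; "SDS"; "DSDS"]%string.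

Definition reps12 : seq string :=
  [:: ""; "S"; "NS"; "DS"; "DNS"; "SNS"; "SDNS"; "DSDNS"; "NDSDNS";
      "SDSDNS"]%string.

(** Finding such words is a search, for instance breadth first among the words
    whose matrices have small entries; checking them is a multiplication.  The
    sixth word of [words13], for example, is $(MN)^5 = -1$. *)
Definition words13 : seq string :=
  [:: ""; "N"; "mmnmnmmmnmnmmmnmnmmnmnmmmnmnmmNMNmnmnmNMNM";
      "nMNMNMMNMNMMMMNMNMnMNMNMMNMNMnMMNMNMnmnm";
      "mnMNMNMnmnmmnmnmmnmnmmnnmnmnMnmmnmnmNMNM"; "MNMNMNMNMN";
      "mnmnMNMNMnmnmmnmnmNMNM"; "MNMNMMNMNMnmnmmnmnmmnmnmNMNMN";
      "mnmnMNMNMnmmnmnmmnMNMNMnmnmN"; "mnmnMNMNMMnmnmmnmnmmmnmnmmmnmnmN";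
      "mnMNMNMnmnmmnMNMNMnmnmmnMNMNMnmnm";
      "MNMNMMNMNMMMNMNMnmmnmnmNmnmnmmNMNMNNMMNMNMMNMN"]%string.

Definition words12 : seq string :=
  [:: ""; "N"; "nMNMNNmnmNMnMNMnmnmN"; "MNNMNNMNNMNN";
      "NMNNNMNMnmnMnmnnmnnnmn"; "NMNmnmnnnnmnmNMNNmnmNNNN"; "nMNMNmnmN";
      "NNNmnmNMNMNmmnmnMNMnMNMnmnmm"; "NNmnmNMNMnnMNMnmnm"; "MNmnmnMNMMNmnm";
      "NNmnmNMMNMnmnmNMnn"; "MNmnmnnnMNMnmnnMNMMNNMNMNMnMNMnmnm";
      "MMNMNNmnmNmnmnnnmnmNMNmNMMNMnmnm"; "MNMNmnmnmnnmnMnmnMNMNMNMnmnm";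
      "NmnMNMNNNmnmmnMNMnMMMNMnmnmNMnmnmN"]%string.

Lemma coset_table13 : coset_table 1 3 [:: quintuple_vecs] reps13 words13.
Proof. by vm_compute. Qed.

Lemma coset_table12 :
  coset_table 1 2 [:: triple1_vecs; triple2_vecs] reps12 words12.
Proof. by vm_compute. Qed.

Lemma vecE a b c d : vec [:: a; b; c; d] = vec4 a%:~R b%:~R c%:~R d%:~R.
Proof. by apply/colP => i; rewrite !mxE; case: i => [[|[|[|[|i]]]] ?]. Qed.

Lemma quintupleE : block quintuple_vecs = quintuple.
Proof.
by apply/setP => v; rewrite /block /= !vecE !mulr0z !mulr1z !inE !orbA.
Qed.

Lemma triple1E : block triple1_vecs = triple1.
Proof.
by apply/setP => v; rewrite /block /= !vecE !mulr0z !mulr1z !inE !orbA.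
Qed.

Lemma triple2E : block triple2_vecs = triple2.
Proof.
by apply/setP => v; rewrite /block /= !vecE !mulr0z !mulr1z !inE !orbA.
Qed.

Lemma blocks1 s : blocks [:: s] = [set block s]%SET.
Proof. by apply/setP => V; rewrite !inE. Qed.

Lemma blocks2 s t : blocks [:: s; t] = [set block s; block t]%SET.
Proof. by apply/setP => V; rewrite !inE. Qed.
End Reduction.

Theorem theorem4 :
  (has_index (G 1 3) 6 /\
   (forall A : sp4, G 1 3 A <-> mod2_act A quintuple = quintuple)) /\
  (has_index (G 1 2) 10 /\
   (forall A : sp4,
      G 1 2 A <->
      [set mod2_act A triple1; mod2_act A triple2]%SET
        = [set triple1; triple2]%SET)).
Proof.
have [index13 G13] := coset_table_correct coset_table13.
have [index12 G12] := coset_table_correct coset_table12.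
split; split=> // A; rewrite ?G13 ?G12 ?blocks1 ?blocks2 /block_act.
  rewrite imset_set1 quintupleE.
  by split=> [/set1_inj|->].
by rewrite imsetU1 imset_set1 triple1E triple2E.
Qed.
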